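(* Let $\mathcal{C}$ be a category and let $F:\mathcal{J}\to\mathsf{L}(\mathcal{C})$ be a finite diagram (i.e. $\mathcal{J}$ is a finite category). If the Limit Procedure described in the context succeeds for $F$, then its output cone $((L,\mathbf{L}),\varepsilon\circ\eta)$, whose component at $j\in\mathcal{J}$ is $\varepsilon_j\circ(\mathrm{id}_L,\eta_j)=(\rho_j,\eta_j):(L,\mathbf{L})\to Fj$, is a limit of $F$ in $\mathsf{L}(\mathcal{C})$.
   Context: Intervals. For a poset $P$, an interval in $P$ is a pair $[a,a']$ with $a,a'\in P$, $a\le a'$. The set $[P]$ of intervals is partially ordered by $\supseteq$, where $[a,a']\supseteq[b,b']$ iff $a\le b$ and $b'\le a'$; as a thin category, $[P]$ has a unique arrow $[a,a']\to[b,b']$ exactly when $[a,a']\supseteq[b,b']$. A monotone map $f:P\to Q$ induces $[f]:[P]\to[Q]$, $[a,a']\mapsto[f(a),f(a')]$. Labelled intervals. $\mathrm{FPos}$ is the category of finite posets and monotone maps. $\mathsf{L}(\mathcal{C})$ has as objects pairs $(P,X)$ with $P$ a finite poset and $X:[P]\to\mathcal{C}$ a functor, and as morphisms $(P,X)\to(Q,Y)$ pairs $(f,\alpha)$ with $f:P\to Q$ monotone and $\alpha:X\Rightarrow Y\circ[f]$ natural; composition is $(g,\beta)\circ(f,\alpha)=(g\circ f,\beta_{[f]}\circ\alpha)$. Write $x=(x^0,x^1)$ for the two components of an object or morphism of $\mathsf{L}(\mathcal{C})$; $U:\mathsf{L}(\mathcal{C})\to\mathrm{FPos}$ is the projection $x\mapsto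 x^0$. For a functor category, $\mathrm{ev}_{c}$ denotes evaluation at $c$. Limit Procedure, for a finite diagram $F:\mathcal{J}\to\mathsf{L}(\mathcal{C})$: (1) Take the limit $(L,\rho)$ of $U\circ F:\mathcal{J}\to\mathrm{FPos}$ (it exists since $\mathrm{FPos}$ is finitely complete). (2) Define $G:\mathcal{J}\to\mathrm{Func}([L],\mathcal{C})$ by $Gj:=(Fj)^1\circ[\rho_j]$ and, for $h:j\to j'$ in $\mathcal{J}$, $(Gh)_{[a,b]}:=(Fh)^1_{[\rho_j][a,b]}:(Fj)^1[\rho_j][a,b]\to(Fj')^1[\rho_{j'}][a,b]$. (3) Let $\varepsilon_j:=(\rho_j,\mathrm{id}_{Gj}):(L,Gj)\to Fj$. (4) For each interval $[a,b]$ in $L$, take a limit $(\mathbf{L}_{[a,b]},\eta_{[a,b]})$ of $\mathrm{ev}_{[a,b]}\circ G:\mathcal{J}\to\mathcal{C}$ if it exists; if for some interval it does not exist, the procedure fails (otherwise it succeeds). (5) For $[a,b]\supseteq[c,d]$, the object $\mathbf{L}_{[a,b]}$ with the legs $(Gj)([a,b]\supseteq[c,d])\circ(\eta_{[a,b]})_j$ is a cone over $\mathrm{ev}_{[c,d]}\circ G$; let $\mathbf{L}_{[a,b]\supseteq[c,d]}:\mathbf{L}_{[a,b]}\to\mathbf{L}_{[c,d]}$ be the induced map of cones given by the universal property of $\mathbf{L}_{[c,d]}$. (6) Let $\mathbf{L}:[L]\to\mathcal{C}$ be the functor $[a,b]\mapsto\mathbf{L}_{[a,b]}$, $([a,b]\supseteq[c,d])\mapsto\mathbf{L}_{[a,b]\supseteq[c,d]}$,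 and let $\eta_j:\mathbf{L}\Rightarrow Gj$ have components $(\eta_j)_{[a,b]}:=(\eta_{[a,b]})_j$. (7) Output the object $(L,\mathbf{L})$ with the cone over $F$ having components $\varepsilon_j\circ(\mathrm{id}_L,\eta_j)$. *)

(* Defs.v *)
From mathcomp Require Import all_boot all_order.
From mathcomp Require Import boolp.

Set Implicit Arguments.
Unset Strict Implicit.
Unset Printing Implicit Defensive.

Import Order.TTheory.
Local Open Scope order_scope.
Local Obligation Tactic := idtac.

(** * Categories, functors, natural transformations *)

(* All records below have primitive projections, so that eta holds by
   conversion; in particular the functors [g \o f] and [g] \o [f] have
   convertible actions on objects and on arrows. *)
Set Primitive Projections.

Record category := Category {
  ob :> Type;
  hom : ob -> ob -> Type;
  idm : forall x, hom x x;
  comp : forall x y z, hom y z -> hom x y -> hom x z;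
  comp_idl : forall x y (f : hom x y), comp (idm y) f = f;
  comp_idr : forall x y (f : hom x y), comp f (idm x) = f;
  comp_assoc : forall x y z w (h : hom z w) (g : hom y z) (f : hom x y),
    comp h (comp g f) = comp (comp h g) f }.

Arguments hom {c} _ _.
Arguments idm {c} x.
Arguments comp {c x y z} _ _.

Notation "g ∘ f" := (comp g f) (at level 40, left associativity).

(* [finite_set] from mathcomp-classical would force the universe of [category]
   below that of [finPOrderType], excluding the category of finite posets. *)
Definition is_finite (T : Type) : Prop :=
  exists (n : nat) (f : 'I_n -> T), forall x : T, exists i, f i = x.

Definition finite_category (J : category) : Prop :=
  is_finite J /\ forall j k : J, is_finite (hom j k).

(* The identity, seen as an arrow between two propositionally equal objects. *)
Definition eq_arrow (C : category) (x y : C) (e : x = y) : hom x y :=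
  match e in _ = z return hom x z with erefl => idm x end.

Record functor (C D : category) := Functor {
  fobj :> C -> D;
  fmap : forall x y : C, hom x y -> hom (fobj x) (fobj y);
  fmap_id : forall x : C, fmap (idm x) = idm (fobj x);
  fmap_comp : forall (x y z : C) (g : hom y z) (f : hom x y),
    fmap (g ∘ f) = fmap g ∘ fmap f }.

Arguments fmap {C D} _ {x y} _.

Program Definition functor_comp (B C D : category) (G : functor C D)
    (F : functor B C) : functor B D :=
  {| fobj := fun x => G (F x);
     fmap := fun x y f => fmap G (fmap F f) |}.
Next Obligation. by move=> B C D G F x /=; rewrite !fmap_id. Qed.
Next Obligation. by move=> B C D G F x y z g f /=; rewrite !fmap_comp. Qed.

Record nat_trans (C D : category) (F G : functor C D) := NatTrans {
  ncomp :> forall x : C, hom (F x) (G x);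
  nat_comm : forall (x y : C) (f : hom x y),
    fmap G f ∘ ncomp x = ncomp y ∘ fmap F f }.

Lemma nat_trans_eq (C D : category) (F G : functor C D) (a b : nat_trans F G) :
  (forall x, a x = b x) -> a = b.
Proof.
case: a b => [a ha] [b hb] /= ab.
have {}ab : a = b by apply: functional_extensionality_dep.
by case: b / ab hb => hb; rewrite (Prop_irrelevance ha hb).
Qed.

Program Definition nat_id (C D : category) (F : functor C D) : nat_trans F F :=
  {| ncomp := fun x => idm (F x) |}.
Next Obligation. by move=> C D F x y f; rewrite comp_idl comp_idr. Qed.

Program Definition nat_vcomp (C D : category) (F G H : functor C D)
    (b : nat_trans G H) (a : nat_trans F G) : nat_trans F H :=
  {| ncomp := fun x => b x ∘ a x |}.
Next Obligation.
move=> C D F G H b a x y f /=.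
by rewrite comp_assoc nat_comm -!comp_assoc nat_comm.
Qed.

Program Definition functor_category (C D : category) : category :=
  {| ob := functor C D;
     hom := @nat_trans C D;
     idm := @nat_id C D;
     comp := @nat_vcomp C D |}.
Next Obligation.
by move=> C D *; apply: nat_trans_eq => i /=; rewrite comp_idl.
Qed.
Next Obligation.
by move=> C D *; apply: nat_trans_eq => i /=; rewrite comp_idr.
Qed.
Next Obligation.
by move=> C D *; apply: nat_trans_eq => i /=; rewrite comp_assoc.
Qed.

Definition ev (C D : category) (c : C) : functor (functor_category C D) D :=
  @Functor (functor_category C D) D (fun F => fobj F c) (fun F G a => ncomp a c)
    (fun=> erefl) (fun _ _ _ _ _ => erefl).

(** * Limits *)

Record cone (J C : category) (F : functor J C) := Cone {
  apex : C;
  leg : forall j : J, hom apex (F j);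
  cone_comm : forall (j k : J) (h : hom j k), fmap F h ∘ leg j = leg k }.

Definition is_limit (J C : category) (F : functor J C) (c : cone F) : Prop :=
  forall c' : cone F,
    exists! m : hom (apex c') (apex c), forall j, leg c j ∘ m = leg c' j.

Record limit (J C : category) (F : functor J C) := Limit {
  lim_cone :> cone F;
  lim_univ : is_limit lim_cone }.

Definition mediator (J C : category) (F : functor J C) (c : limit F)
    (c' : cone F) : hom (apex c') (apex c) :=
  projT1 (cid (lim_univ c c')).

Lemma mediatorE (J C : category) (F : functor J C) (c : limit F) (c' : cone F)
    (j : J) :
  leg c j ∘ mediator c c' = leg c' j.
Proof. by rewrite /mediator; case: cid => m [/= hm _]; apply: hm. Qed.

Lemma limit_ext (J C : category) (F : functor J C) (c : limit F) (x : C)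
    (f g : hom x (apex c)) :
  (forall j, leg c j ∘ f = leg c j ∘ g) -> f = g.
Proof.
move=> fg; have gC j k (h : hom j k) : fmap F h ∘ (leg c j ∘ g) = leg c k ∘ g.
  by rewrite comp_assoc cone_comm.
have [m [_ mU]] := lim_univ c (Cone gC).
by rewrite -(mU f fg) -(mU g (fun=> erefl)).
Qed.

(** * Finite posets *)

Record fpos := FPos {
  fpos_disp : Order.disp_t;
  fpos_sort :> finPOrderType fpos_disp }.

Record mono (d d' : Order.disp_t) (P : porderType d) (Q : porderType d') :=
  Mono {
    mono_fun :> P -> Q;
    mono_le : {homo mono_fun : a b / a <= b} }.

Lemma mono_eq d d' (P : porderType d) (Q : porderType d') (f g : mono P Q) :
  (forall a, f a = g a) -> f = g.
Proof.
case: f g => [f hf] [g hg] /= fg.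
have {}fg : f = g by apply: functional_extensionality_dep.
by case: g / fg hg => hg; rewrite (Prop_irrelevance hf hg).
Qed.

Definition mono_id d (P : porderType d) : mono P P := Mono (fun _ _ h => h).

Definition mono_comp d d' d'' (P : porderType d) (Q : porderType d')
    (R : porderType d'') (g : mono Q R) (f : mono P Q) : mono P R :=
  Mono (fun a b h => mono_le g (mono_le f h)).

Definition FPos_category : category :=
  @Category fpos (fun P Q => mono P Q) (fun P => mono_id P)
    (fun _ _ _ g f => mono_comp g f)
    (fun _ _ _ => erefl) (fun _ _ _ => erefl) (fun _ _ _ _ _ _ _ => erefl).

(** * Intervals *)

Record ival (d : Order.disp_t) (P : porderType d) := Ival {
  lo : P;
  hi : P;
  lo_le_hi : lo <= hi }.

(* [ival_sup i j] is i ⊇ j. *)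
Record ival_sup d (P : porderType d) (i j : ival P) : Prop := IvalSup {
  sup_lo : lo i <= lo j;
  sup_hi : hi j <= hi i }.

Lemma ival_sup_irr d (P : porderType d) (i j : ival P) (h h' : ival_sup i j) :
  h = h'.
Proof. exact: Prop_irrelevance. Qed.

Lemma ival_sup_refl d (P : porderType d) (i : ival P) : ival_sup i i.
Proof. by split. Qed.

Lemma ival_sup_trans d (P : porderType d) (i j k : ival P) :
  ival_sup j k -> ival_sup i j -> ival_sup i k.
Proof.
move=> [jk kj] [ij ji]; split; first exact: le_trans ij jk.
exact: le_trans kj ji.
Qed.

Definition ival_category d (P : porderType d) : category :=
  @Category (ival P) (@ival_sup d P) (@ival_sup_refl d P)
    (@ival_sup_trans d P)
    (fun _ _ _ => ival_sup_irr _ _) (fun _ _ _ => ival_sup_irr _ _)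
    (fun _ _ _ _ _ _ _ => ival_sup_irr _ _).

(* [ival_map f] is [f] : [P] -> [Q], as a functor. *)
Definition ival_map d d' (P : porderType d) (Q : porderType d') (f : mono P Q) :
    functor (ival_category P) (ival_category Q) :=
  @Functor (ival_category P) (ival_category Q)
    (fun i => Ival (mono_le f (lo_le_hi i)))
    (fun i j h => IvalSup (i := Ival (mono_le f (lo_le_hi i)))
       (j := Ival (mono_le f (lo_le_hi j)))
       (mono_le f (sup_lo h)) (mono_le f (sup_hi h)))
    (fun _ => ival_sup_irr _ _) (fun _ _ _ _ _ => ival_sup_irr _ _).

(** * Labelled intervals *)

Record lab_ob (C : category) := LabOb {
  base : fpos;
  label : functor (ival_category base) C }.

Record lab_hom (C : category) (x y : lab_ob C) := LabHom {
  base_hom : mono (base x) (base y);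
  label_hom : nat_trans (label x) (functor_comp (label y) (ival_map base_hom)) }.

Program Definition lab_id (C : category) (x : lab_ob C) : lab_hom x x :=
  {| base_hom := mono_id (base x);
     label_hom := {| ncomp := fun i => idm (label x i) |} |}.
Next Obligation.
move=> C x i j h /=; rewrite comp_idl comp_idr.
by congr (fmap _ _); apply: ival_sup_irr.
Qed.

Program Definition lab_comp (C : category) (x y z : lab_ob C)
    (g : lab_hom y z) (f : lab_hom x y) : lab_hom x z :=
  {| base_hom := mono_comp (base_hom g) (base_hom f);
     label_hom := {| ncomp := fun i =>
       label_hom g (ival_map (base_hom f) i) ∘ label_hom f i |} |}.
Next Obligation.
move=> C x y z g f i j h /=.
rewrite -[RHS]comp_assoc -(nat_comm (label_hom f)) !comp_assoc.
by congr (_ ∘ _); exact: (nat_comm (label_hom g) (fmap (ival_map (base_hom f)) h)).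
Qed.

Lemma lab_hom_eq (C : category) (x y : lab_ob C) (f : mono (base x) (base y))
    (a b : nat_trans (label x) (functor_comp (label y) (ival_map f))) :
  (forall i, a i = b i) -> LabHom a = LabHom b.
Proof. by move=> ab; rewrite (nat_trans_eq ab). Qed.

Lemma lab_hom_eq_base (C : category) (x y : lab_ob C) (p q : lab_hom x y) :
  base_hom p = base_hom q ->
  (forall (i : ival (base x))
     (s : ival_sup (ival_map (base_hom p) i) (ival_map (base_hom q) i)),
     fmap (label y) (s : @hom (ival_category _) _ _) ∘ label_hom p i =
     label_hom q i) ->
  p = q.
Proof.
case: p q => [f a] [g b] /= fg; case: g / fg b => b ab.
apply: lab_hom_eq => i; rewrite -(ab i (ival_sup_refl _)).
have -> := fmap_id (label y) (ival_map f i : ival_category _).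
by rewrite comp_idl.
Qed.

Program Definition lab_category (C : category) : category :=
  {| ob := lab_ob C;
     hom := @lab_hom C;
     idm := @lab_id C;
     comp := @lab_comp C |}.
Next Obligation.
move=> C x y f.
by apply: (@lab_hom_eq C x y (base_hom f)) => i /=; rewrite comp_idl.
Qed.
Next Obligation.
move=> C x y f.
by apply: (@lab_hom_eq C x y (base_hom f)) => i /=; rewrite comp_idr.
Qed.
Next Obligation.
move=> C x y z w h g f; pose k := lab_comp h (lab_comp g f).
by apply: (@lab_hom_eq C x w (base_hom k)) => i /=; rewrite comp_assoc.
Qed.

Definition lab_proj (C : category) : functor (lab_category C) FPos_category :=
  @Functor (lab_category C) FPos_category (@base C) (@base_hom C)
    (fun=> erefl) (fun _ _ _ _ _ => erefl).

(* The morphism (id_P, a) : (P, X) -> (P, Y). *)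
Program Definition lab_vert (C : category) (P : fpos)
    (X Y : functor (ival_category P) C) (a : nat_trans X Y) :
    @lab_hom C (LabOb X) (LabOb Y) :=
  {| base_hom := mono_id P;
     label_hom := {| ncomp := fun i => a i |} |}.
Next Obligation.
by move=> C P X Y a i j h /=; rewrite -nat_comm.
Qed.

(** * The limit procedure *)

Lemma eq_arrow_thin (C : category) d (P : porderType d)
    (X : functor (ival_category P) C) (i j : ival P) (e : i = j)
    (h : ival_sup i j) :
  eq_arrow (f_equal X e) = fmap X (h : @hom (ival_category P) i j).
Proof.
case: j / e h => h /=; rewrite -fmap_id.
by congr (fmap _ _); apply: ival_sup_irr.
Qed.

Section LimitProcedure.

Variables (J C : category) (F : functor J (lab_category C)).

(* K is (L, rho); FPos is finitely complete, but no particular limit is fixed. *)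
Variable K : limit (functor_comp (lab_proj C) F).

Let L : fpos := apex K.
Let rho (j : J) : mono L (base (F j)) := leg K j.

Definition proc_G_ob (j : J) : functor (ival_category L) C :=
  functor_comp (label (F j)) (ival_map (rho j)).

Lemma rho_comm (j k : J) (h : hom j k) (i : ival L) :
  ival_map (base_hom (fmap F h)) (ival_map (rho j) i) = ival_map (rho k) i.
Proof.
exact: (f_equal (fun f : mono L (base (F k)) => ival_map f i) (cone_comm K h)).
Qed.

(* (Fh)^1 at [rho_j][a,b] lands in (Fk)^1 [(Fh)^0] [rho_j] [a,b]; since
   (Fh)^0 \o rho_j = rho_k holds only propositionally, it is followed by the
   identity arrow to (Fk)^1 [rho_k] [a,b]. *)
Definition proc_G_comp (j k : J) (h : hom j k) (i : ival L) :
    hom (proc_G_ob j i) (proc_G_ob k i) :=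
  eq_arrow (f_equal (label (F k)) (rho_comm h i))
  ∘ label_hom (fmap F h) (ival_map (rho j) i).

Lemma rho_sup (j k : J) (h : hom j k) (i : ival L) :
  ival_sup (ival_map (base_hom (fmap F h)) (ival_map (rho j) i))
           (ival_map (rho k) i).
Proof. by rewrite rho_comm; apply: ival_sup_refl. Qed.

Lemma proc_G_compE (j k : J) (h : hom j k) (i : ival L) :
  proc_G_comp h i =
  fmap (label (F k)) (rho_sup h i : @hom (ival_category _) _ _)
  ∘ label_hom (fmap F h) (ival_map (rho j) i).
Proof. by rewrite /proc_G_comp (eq_arrow_thin _ _ (rho_sup h i)). Qed.

Program Definition proc_G_hom (j k : J) (h : hom j k) :
    nat_trans (proc_G_ob j) (proc_G_ob k) :=
  {| ncomp := proc_G_comp h |}.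
Next Obligation.
move=> j k h i i' s; rewrite !proc_G_compE -comp_assoc.
rewrite -(nat_comm (label_hom (fmap F h))) /= !comp_assoc -!fmap_comp.
by congr (fmap _ _ ∘ _); apply: ival_sup_irr.
Qed.

Lemma lab_hom_transport (x y : lab_ob C) (p q : lab_hom x y) (e : p = q)
    (i : ival (base x)) (j : ival (base y))
    (s : ival_sup (ival_map (base_hom p) i) j)
    (t : ival_sup (ival_map (base_hom q) i) j) :
  fmap (label y) (s : @hom (ival_category _) _ _) ∘ label_hom p i =
  fmap (label y) (t : @hom (ival_category _) _ _) ∘ label_hom q i.
Proof. by case: q / e t => t; rewrite (ival_sup_irr s t). Qed.

Program Definition proc_G : functor J (functor_category (ival_category L) C) :=
  @Functor J (functor_category (ival_category L) C) proc_G_ob proc_G_hom _ _.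
Next Obligation.
move=> j; apply: nat_trans_eq => i /=; rewrite proc_G_compE.
rewrite (lab_hom_transport (fmap_id F j) _ (ival_sup_refl _)) /= comp_idr.
by rewrite -fmap_id; congr (fmap _ _); apply: ival_sup_irr.
Qed.
Next Obligation.
move=> j k l g h; apply: nat_trans_eq => i /=; rewrite !proc_G_compE.
have s : ival_sup (ival_map (base_hom (fmap F g ∘ fmap F h))
    (ival_map (rho j) i)) (ival_map (rho l) i).
  by rewrite -fmap_comp; apply: rho_sup.
rewrite (lab_hom_transport (fmap_comp F g h) _ s) /=.
rewrite -[RHS]comp_assoc [X in _ = _ ∘ X]comp_assoc.
rewrite -(nat_comm (label_hom (fmap F g))) /= !comp_assoc -!fmap_comp.
by congr (fmap _ _ ∘ _ ∘ _); apply: ival_sup_irr.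
Qed.

Definition proc_eps (j : J) : lab_hom (LabOb (proc_G j)) (F j) :=
  @LabHom C (LabOb (proc_G j)) (F j) (rho j) (nat_id (proc_G j)).

(* The procedure succeeds exactly when such a family of limits exists. *)
Variable E :
  forall i : ival_category L, limit (functor_comp (ev C i) proc_G).

Program Definition proc_res_cone (i i' : ival_category L) (s : hom i i') :
    cone (functor_comp (ev C i') proc_G) :=
  {| apex := apex (E i);
     leg := fun j => fmap (proc_G j) s ∘ leg (E i) j |}.
Next Obligation.
move=> i i' s j k h /=; rewrite comp_assoc.
rewrite -(nat_comm (proc_G_hom h) s) -comp_assoc; congr (_ ∘ _).
exact: (cone_comm (E i) h).
Qed.

Definition proc_res (i i' : ival_category L) (s : hom i i') :
    hom (apex (E i)) (apex (E i')) :=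
  mediator (E i') (proc_res_cone s).

Lemma proc_resE (i i' : ival_category L) (s : hom i i') (j : J) :
  leg (E i') j ∘ proc_res s = fmap (proc_G j) s ∘ leg (E i) j.
Proof. exact: (mediatorE (E i') (proc_res_cone s)). Qed.

Program Definition proc_label : functor (ival_category L) C :=
  @Functor (ival_category L) C (fun i => apex (E i)) proc_res _ _.
Next Obligation.
move=> i; apply: (limit_ext (c := E i)) => j.
by rewrite proc_resE fmap_id comp_idl comp_idr.
Qed.
Next Obligation.
move=> i i' i'' s' s; apply: (limit_ext (c := E i'')) => j.
by rewrite comp_assoc !proc_resE fmap_comp -!comp_assoc proc_resE.
Qed.

Program Definition proc_eta (j : J) : nat_trans proc_label (proc_G j) :=
  {| ncomp := fun i => leg (E i) j |}.
Next Obligation. by move=> j i i' s; rewrite [RHS]proc_resE. Qed.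

Program Definition proc_output : cone F :=
  {| apex := LabOb proc_label : lab_category C;
     leg := fun j => (proc_eps j : @hom (lab_category C) _ _)
                     ∘ lab_vert (proc_eta j) |}.
Next Obligation.
move=> j k h; apply: lab_hom_eq_base => [|i s]; first exact: (cone_comm K h).
have Ek := cone_comm (E i) h; rewrite /= proc_G_compE in Ek.
rewrite /= !comp_idl -Ek !comp_assoc; congr (fmap _ _ ∘ _ ∘ _).
exact: ival_sup_irr.
Qed.

End LimitProcedure.

(* Main.v *)
Require Import Defs.
From mathcomp Require Import all_boot all_order.

(** A cone over [F] with apex [(Q, Y)] and legs [(f_j, a_j)] has a unique
    factorisation [m : Q -> L] on base posets. Over an interval [i] of [Q], the
    arrows [(a_j)_i] form a cone over [G] evaluated at [[m] i], so they factor
    uniquely through the limit at [[m] i]; these factorisations are natural in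
    [i] because the legs of a limit cone are jointly monic. *)

Set Implicit Arguments.
Unset Strict Implicit.

Section Factorisation.

Variables (C J : category) (F : functor J (lab_category C)).
Variable K : limit (functor_comp (lab_proj C) F).
Variable E :
  forall i : ival_category (apex K), limit (functor_comp (ev C i) (proc_G K)).
Variable c : cone F.

Let Q : fpos := base (apex c).
Let Y : functor (ival_category Q) C := label (apex c).
Let l (j : J) : lab_hom (apex c) (F j) := leg c j.
Let rho (j : J) : mono (apex K) (base (F j)) := leg K j.

Definition base_cone : cone (functor_comp (lab_proj C) F) :=
  @Cone _ _ (functor_comp (lab_proj C) F) Q (fun j => base_hom (l j))
    (fun j k h => f_equal (@base_hom _ _ _) (cone_comm c h)).

Definition base_factor : mono Q (apex K) := mediator K base_cone.

Lemma base_factorE (j : J) :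
  mono_comp (rho j) base_factor = base_hom (l j).
Proof. exact: (mediatorE K base_cone j). Qed.

(* The two intervals are equal, but only propositionally; a containment makes
   the transport between the corresponding labels an arrow of the thin category
   of intervals. *)
Lemma base_factor_sup (j : J) (i : ival Q) :
  ival_sup (ival_map (base_hom (l j)) i)
           (ival_map (rho j) (ival_map base_factor i)).
Proof. by rewrite -base_factorE; apply: ival_sup_refl. Qed.

Definition label_leg (i : ival Q) (j : J) :
    hom (Y i) (proc_G K j (ival_map base_factor i)) :=
  fmap (label (F j)) (base_factor_sup j i : @hom (ival_category _) _ _)
  ∘ label_hom (l j) i.

(** This is the label part of the cone equation for [c] at [h], read over the image of [i] in the
    base of [F k]. Naturality of the label of [fmap F h] moves the containment past it, and parallel
    containments are equal. *)
Lemma label_leg_comm (i : ival Q) (j k : J) (h : hom j k) :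
  proc_G_comp h (ival_map base_factor i) ∘ label_leg i j = label_leg i k.
Proof.
rewrite proc_G_compE /label_leg.
have s : ival_sup (ival_map (base_hom (fmap F h ∘ leg c j)) i)
    (ival_map (rho k) (ival_map base_factor i)).
  by rewrite (cone_comm c h); apply: base_factor_sup.
rewrite -(lab_hom_transport (cone_comm c h) s) /=.
rewrite -comp_assoc [X in _ ∘ X = _]comp_assoc.
rewrite -(nat_comm (label_hom (fmap F h))) /= !comp_assoc -!fmap_comp.
by congr (fmap _ _ ∘ _ ∘ _); apply: ival_sup_irr.
Qed.

Definition label_cone (i : ival Q) :
    cone (functor_comp (ev C (ival_map base_factor i)) (proc_G K)) :=
  @Cone _ _ (functor_comp (ev C (ival_map base_factor i)) (proc_G K))
    (Y i) (label_leg i) (label_leg_comm i).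

Definition label_factor (i : ival Q) :
    hom (Y i) (proc_label E (ival_map base_factor i)) :=
  mediator (E (ival_map base_factor i)) (label_cone i).

Lemma label_factorE (i : ival Q) (j : J) :
  leg (E (ival_map base_factor i)) j ∘ label_factor i = label_leg i j.
Proof. exact: (mediatorE (E (ival_map base_factor i)) (label_cone i)). Qed.

Lemma label_factor_nat (i i' : ival_category Q) (s : hom i i') :
  fmap (functor_comp (proc_label E) (ival_map base_factor)) s ∘ label_factor i
  = label_factor i' ∘ fmap Y s.
Proof.
apply: (limit_ext (c := E (ival_map base_factor i'))) => j.
rewrite !comp_assoc label_factorE proc_resE -comp_assoc label_factorE.
rewrite /label_leg -comp_assoc -(nat_comm (label_hom (l j))) /=.
rewrite !comp_assoc -!fmap_comp.
by congr (fmap _ _ ∘ _); apply: ival_sup_irr.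
Qed.

Definition factor : lab_hom (apex c) (LabOb (proc_label E)) :=
  @LabHom C (apex c) (LabOb (proc_label E)) base_factor
    (NatTrans label_factor_nat).

End Factorisation.

(** [proc_eps] contributes only identity labels and [lab_vert] only an identity base map, so one
    identity law on labels remains. *)
Lemma leg_proc_output (C J : category) (F : functor J (lab_category C))
    (K : limit (functor_comp (lab_proj C) F))
    (E : forall i : ival_category (apex K),
       limit (functor_comp (ev C i) (proc_G K))) (j : J) :
  leg (proc_output E) j =
  @LabHom C (LabOb (proc_label E)) (F j) (leg K j) (proc_eta E j).
Proof.
apply: (@lab_hom_eq C (LabOb (proc_label E)) (F j) (leg K j)) => i /=.
exact: comp_idl.
Qed.

Theorem theorem4p5 (C J : category) (J_finite : finite_category J)
    (F : functor J (lab_category C))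
    (K : limit (functor_comp (lab_proj C) F))
    (E : forall i : ival_category (apex K),
       limit (functor_comp (ev C i) (proc_G K))) :
  (forall j : J,
     leg (proc_output E) j =
     @LabHom C (LabOb (proc_label E)) (F j) (leg K j) (proc_eta E j))
  /\ is_limit (proc_output E).
Proof.
split=> [|c]; first exact: leg_proc_output.
exists (factor E c); split=> [j|[m a] ma].
  rewrite leg_proc_output; apply: lab_hom_eq_base => [|i s].
    exact: (base_factorE K c j).
  (* [s] runs opposite to the containment in [label_leg]; by thinness their composite is an
     identity. *)
  rewrite /= label_factorE /label_leg comp_assoc -fmap_comp.
  rewrite -[RHS]comp_idl -fmap_id.
  by congr (fmap _ _ ∘ _); apply: ival_sup_irr.
have em : base_factor K c = m.
  apply: (limit_ext (c := K)) => j; rewrite [LHS]base_factorE -(ma j).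
  by rewrite leg_proc_output.
apply: lab_hom_eq_base => [|i s]; first exact: em.
(* After projecting to [j], [proc_resE] trades the restriction along [s] for a containment in the
   labels of [F j]. *)
apply: (limit_ext (c := E (ival_map m i))) => j.
rewrite comp_assoc [X in X ∘ _ = _](proc_resE E).
rewrite -comp_assoc label_factorE /label_leg.
have {}ma := ma j; rewrite leg_proc_output in ma.
(* The base maps in [ma] agree only propositionally, so the labels are compared over one common
   interval. *)
have t : ival_sup (ival_map (base_hom (leg c j)) i)
    (ival_map (leg K j : mono _ _) (ival_map m i)).
  by rewrite -ma; apply: ival_sup_refl.
have := lab_hom_transport ma (ival_sup_refl _) t.
rewrite fmap_id comp_idl comp_assoc -fmap_comp /= => ->.
by congr (fmap _ _ ∘ _); apply: ival_sup_irr.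
Qed.
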